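(* Every subring of $\overline{\mathbb{Z}}$ has a universal grading.
   Context: $\overline{\mathbb{Z}}$ is the ring of algebraic integers in an algebraic closure $\overline{\mathbb{Q}}$ of $\mathbb{Q}$. A grading of a ring $R$ is a pair $(G,\{R_g\}_{g\in G})$ such that $G$ is an abelian group (written multiplicatively), $R_g$ is an additive subgroup of $R$ for all $g\in G$, the natural map $\bigoplus_{g\in G}R_g\to R$ is an isomorphism of groups, and $R_gR_{g'}\subseteq R_{gg'}$ for all $g,g'\in G$. A grading $(G,\{R_g\}_g)$ of $R$ is universal if for each grading $(H,\{S_h\}_h)$ of $R$ there exists a unique group homomorphism $f:G\to H$ such that $S_h=\sum_{g\in f^{-1}(h)}R_g$ for all $h\in H$. *)

(* Defs.v *)
From HB Require Import structures.
From mathcomp Require Import all_boot all_order all_algebra all_field.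
From mathcomp Require Import finmap.
From mathcomp Require Import boolp classical_sets functions.

Set Implicit Arguments.
Unset Strict Implicit.
Unset Printing Implicit Defensive.

Import GRing.Theory.

Local Open Scope classical_set_scope.
Local Open Scope ring_scope.

(* Grading groups are [zmodType]s, i.e. abelian groups written additively. *)

Section Grading.
Variables (R : pzRingType) (G : zmodType).
Implicit Types A : set G.

(* The direct sum of the [R_ g] for [g] in [A], as the finitely supported
   families indexed by [G] that vanish outside [A]. *)
Definition direct_sum A (R_ : G -> set R) : set {fsfun G -> R with 0} :=
  [set u : {fsfun G -> R with 0} |
     (forall g, R_ g (u g)) /\ [set` finsupp u] `<=` A].

Definition sum_map (u : {fsfun G -> R with 0}) : R :=
  \sum_(g <- finsupp u) u g.

(* The subgroup sum of the [R_ g] for [g] in [A]. *)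
Definition sum_subgroups A (R_ : G -> set R) : set R :=
  sum_map @` direct_sum A R_.

(* [sum_map] is additive, so bijectivity makes it a group isomorphism. *)
Record is_grading (R_ : G -> set R) : Prop := IsGrading {
  grading_zmod : forall g, zmod_closed (mem (R_ g));
  grading_direct : set_bij (direct_sum setT R_) setT sum_map;
  grading_mul : forall g g' x y, R_ g x -> R_ g' y -> R_ (g + g') (x * y)
}.

End Grading.

Section Universal.
Variable R : pzRingType.

Definition is_coarsening (G H : zmodType) (R_ : G -> set R) (S_ : H -> set R)
    (f : G -> H) : Prop :=
  forall h, S_ h = sum_subgroups (f @^-1` [set h]) R_.

Definition is_universal_grading (G : zmodType) (R_ : G -> set R) : Prop :=
  is_grading R_ /\
  forall (H : zmodType) (S_ : H -> set R), is_grading S_ ->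
    exists2 f : {additive G -> H}, is_coarsening R_ S_ f &
      forall f' : {additive G -> H}, is_coarsening R_ S_ f' -> f' =1 f.

Definition has_universal_grading : Prop :=
  exists (G : zmodType) (R_ : G -> set R), is_universal_grading R_.

End Universal.

(* Main.v *)
Require Import Defs.
From HB Require Import structures.
From mathcomp Require Import all_boot all_order all_algebra.
From mathcomp Require Import all_fingroup all_field.
From mathcomp Require Import generic_quotient finmap.
From mathcomp Require Import boolp classical_sets functions.

Set Implicit Arguments.
Unset Strict Implicit.
Unset Printing Implicit Defensive.

Import Order.TTheory GRing.Theory Num.Theory.

Local Open Scope quotient_scope.
Local Open Scope ring_scope.

(** Let R be a subring of the ring of algebraic integers. Call an element
    always homogeneous if it is homogeneous in every grading of R. The theorem
    reduces to one fact: R is additively generated by its always homogeneous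
    elements ([sum_of_always_homogeneous]).

    Granting it, the universal grading is forced ([universal_grading_exists]).
    Since R is a domain, the nonzero always homogeneous elements form a monoid,
    and identifying two of them when they have the same degree in each grading
    is a congruence. The quotient G is a group because degrees are torsion: an
    integral equation for x, read in the degree of its leading term, bounds the
    order of the degree of x in terms of x alone ([degree_torsion]). The
    elements of a class, with 0, form a subgroup R_g. These subgroups generate
    R, and they are independent because two classes are separated by some
    grading. Every grading sends a class to a well-defined degree, and this is
    the unique map from G required by universality.

    The generation statement rests on the size of algebraic integers. Let q(x)
    be the mean of |z|^2 over the conjugates z of x ([mean_sqnorm]). It is at
    least 1 for nonzero algebraic integers, by the inequality between
    arithmetic and geometric means and because a nonzero norm is a nonzero
    integer ([mean_sqnorm_ge1]). The form q comes from a Hermitian inner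
    product, averaged over a Galois group, for which the pieces of any grading
    are orthogonal ([homogeneous_orthogonal]). If x is not homogeneous in some
    grading, then that grading writes x = y + z with y, z nonzero and
    q(x) = q(y) + q(z), so q drops by at least 1 in passing to y or z, and
    repeated splitting ends after finitely many steps with always homogeneous
    elements.

    Orthogonality is usually proved by twisting embeddings with characters of
    the grading group. It is obtained here from the vanishing of the
    subleading coefficient of a minimal polynomial
    ([minPoly_subleading_eq0]), which makes a trace vanish. *)

(** * Gradings in terms of finite families *)

Section DirectSums.
Variables (R : pzRingType) (H : zmodType).

Lemma sum_map_widen (A : {fset H}) (u : {fsfun H -> R with 0}) :
  (finsupp u `<=` A)%fset -> sum_map u = \sum_(h <- A) u h.
Proof.
by move=> uA; apply: big_fset_incl => // h _; rewrite memNfinsupp => /eqP.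
Qed.

(** Turns an ordinary finite sum of homogeneous terms, whose degrees may repeat,
    into a member of the direct sum, to which bijectivity can be applied. *)
Lemma collect_by_degree (I : eqType) (s : seq I) (d : I -> H) (x : I -> R) :
  exists2 u : {fsfun H -> R with 0},
    sum_map u = \sum_(i <- s) x i
    & forall h, u h = \sum_(i <- s | d i == h) x i.
Proof.
pose c h := \sum_(i <- s | d i == h) x i.
pose A : {fset H} := [fset h in map d s]%fset.
have dA i : i \in s -> d i \in A by move=> si; rewrite !inE map_f.
pose u : {fsfun H -> R with 0} := [fsfun h in A => c h | 0].
have c_out h : h \notin A -> c h = 0.
  move=> hA; rewrite /c big_seq_cond big1 // => i /andP[/dA + /eqP dih].
  by rewrite dih (negPf hA).
have uE h : u h = c h by rewrite fsfunE; case: ifPn => // /c_out.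
exists u => //; rewrite (@sum_map_widen A); last first.
  by apply/fsubsetP => h; rewrite mem_finsupp uE; apply: contraR => /c_out ->.
rewrite (eq_bigr c) => [|h _]; last exact: uE.
rewrite /c (exchange_big_dep xpredT) //= big_seq [RHS]big_seq.
apply: eq_bigr => i /dA di; rewrite (eq_bigl (pred1 (d i))) => [|h].
  by rewrite -big_filter filter_pred1_uniq ?big_seq1 ?fset_uniq.
by rewrite /= eq_sym.
Qed.

End DirectSums.

Section GradingTheory.
Variables (R : pzRingType) (H : zmodType) (S_ : H -> set R).
Hypothesis gradS : is_grading S_.

Lemma grading0 h : S_ h 0.
Proof. by have [/set_mem] := grading_zmod gradS h. Qed.

Lemma gradingB h x y : S_ h x -> S_ h y -> S_ h (x - y).
Proof.
move=> Sx Sy; have [_ SB] := grading_zmod gradS h.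
by apply/set_mem/SB; apply/mem_set.
Qed.

Lemma gradingN h x : S_ h x -> S_ h (- x).
Proof. by rewrite -sub0r; apply: gradingB; apply: grading0. Qed.

Lemma gradingD h x y : S_ h x -> S_ h y -> S_ h (x + y).
Proof. by move=> Sx /gradingN; rewrite -{2}[y]opprK; apply: gradingB. Qed.

Lemma grading_sum (I : Type) (s : seq I) (P : pred I) (F : I -> R) h :
  (forall i, P i -> S_ h (F i)) -> S_ h (\sum_(i <- s | P i) F i).
Proof.
move=> SF; elim/big_ind: _ => //; [exact: grading0 | exact: gradingD].
Qed.

Lemma grading_natmul h x n : S_ h x -> S_ h (x *+ n).
Proof.
move=> Sx; elim: n => [|n IHn]; first exact: grading0.
by rewrite mulrS; apply: gradingD.
Qed.

Lemma grading_intmul h x n : S_ h x -> S_ h (x *~ n).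
Proof.
by move=> Sx; case: n => n; [|apply: gradingN]; apply: grading_natmul.
Qed.

(** Directness of the sum in the form used throughout: a relation between
    homogeneous terms holds degree by degree. The degrees need not be
    distinct, so no terms have to be collected beforehand. *)
Lemma grading_component (I : eqType) (s : seq I) (d : I -> H) (x : I -> R)
    (h : H) (y : R) :
    (forall i, S_ (d i) (x i)) -> S_ h y -> \sum_(i <- s) x i = y ->
  forall k, \sum_(i <- s | d i == k) x i = if h == k then y else 0.
Proof.
move=> Sx Sy sum_y k.
have [u sum_u uE] := collect_by_degree s d x.
have [v sum_v vE] := collect_by_degree [:: tt] (fun=> h) (fun=> y).
have [_ inj _] := grading_direct gradS.
have uv : u = v.
  apply: inj; last by rewrite sum_u sum_v big_seq1.
    apply/mem_set; split=> // g.
    by rewrite uE; apply: grading_sum => i /eqP <-.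
  apply/mem_set; split=> // g.
  by rewrite vE; apply: grading_sum => i /eqP <-.
by rewrite -uE uv vE big_mkcond big_seq1.
Qed.

Lemma grading_component_eq0 (I : eqType) (s : seq I) (d : I -> H) (x : I -> R) :
    (forall i, S_ (d i) (x i)) -> \sum_(i <- s) x i = 0 ->
  forall h, \sum_(i <- s | d i == h) x i = 0.
Proof.
by move=> Sx s0 h; rewrite (grading_component Sx (grading0 0) s0); case: eqP.
Qed.

Lemma grading_degree_unique g h x : S_ g x -> S_ h x -> x <> 0 -> g = h.
Proof.
move=> Sg Sh x0; apply/eqP; apply: contra_notT x0 => ne_gh.
have := @grading_component _ [:: tt] (fun=> g) (fun=> x) h x (fun=> Sg) Sh.
rewrite big_seq1 => /(_ erefl g).
by rewrite big_mkcond big_seq1 eqxx eq_sym (negPf ne_gh).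
Qed.

Lemma grading_decomposition x :
  exists (s : seq H) (c : H -> R),
    [/\ uniq s, forall h, S_ h (c h) & x = \sum_(h <- s) c h].
Proof.
have [_ _ surj] := grading_direct gradS.
have [u [Su _] <-] := surj x I.
by exists (finsupp u), u; split; first exact: fset_uniq.
Qed.

(** The degree-zero component of 1 acts as the identity on any nonzero
    homogeneous element, so by cancellation it is 1. *)
Lemma grading1 (dom : forall x y : R, x * y = 0 -> x = 0 \/ y = 0) : S_ 0 1.
Proof.
have [s [c [_ Sc sum_c]]] := grading_decomposition 1.
have [c0|[k ck0]] : (forall k, c k = 0) \/ exists k, c k <> 0.
- by apply: contrapT => /not_orP[/existsNP[k ck] /forallNP/(_ k)].
- by rewrite sum_c big1 //; apply: grading0.
have Sck i : S_ (i + k) (c i * c k) by apply: grading_mul gradS _ _ _ _ _ _.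
have sum_ck : \sum_(i <- s) c i * c k = c k by rewrite -mulr_suml -sum_c mul1r.
have := grading_component Sck (Sc k) sum_ck k; rewrite eqxx -mulr_suml.
move=> /eqP; rewrite -subr_eq0 -{2}[c k]mul1r -mulrBl => /eqP/dom[|//].
move=> /eqP; rewrite subr_eq0 => /eqP <-; apply: grading_sum => i /eqP ik.
by suff <- : i = 0 by []; apply: (addIr k); rewrite add0r.
Qed.

Lemma gradingX (dom : forall x y : R, x * y = 0 -> x = 0 \/ y = 0) h x n :
  S_ h x -> S_ (h *+ n) (x ^+ n).
Proof.
move=> Sx; elim: n => [|n IHn]; first by rewrite expr0 mulr0n; apply: grading1.
by rewrite exprS mulrS; apply: grading_mul gradS _ _ _ _ _ _.
Qed.

End GradingTheory.

(** Injectivity and surjectivity of [sum_map] amount to independence and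
    generation, which are easier to check on sums indexed by a list. *)
Lemma grading_intro (R : pzRingType) (G : zmodType) (R_ : G -> set R) :
    (forall g, R_ g 0) -> (forall g x y, R_ g x -> R_ g y -> R_ g (x - y)) ->
    (forall g g' x y, R_ g x -> R_ g' y -> R_ (g + g') (x * y)) ->
    (forall (s : seq G) (c : G -> R), uniq s -> (forall g, R_ g (c g)) ->
      \sum_(g <- s) c g = 0 -> forall g, g \in s -> c g = 0) ->
    (forall x, exists (s : seq R) (d : R -> G),
      (forall y, y \in s -> R_ (d y) y) /\ x = \sum_(y <- s) y) ->
  is_grading R_.
Proof.
move=> R0 RB RM indep gen.
have RN g x : R_ g x -> R_ g (- x) by rewrite -sub0r; apply: RB.
have RD g x y : R_ g x -> R_ g y -> R_ g (x + y).
  by move=> Rx /RN; rewrite -{2}[y]opprK; apply: RB.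
split=> //.
  move=> g; split=> [|x y /set_mem Rx /set_mem Ry]; apply/mem_set => //.
  exact: RB.
split=> [//|u v /set_mem[Ru _] /set_mem[Rv _] uv|x _].
  pose A := (finsupp u `|` finsupp v)%fset.
  apply/fsfunP => g; apply/eqP; rewrite -subr_eq0; apply/eqP.
  have [gA|] := boolP (g \in A); last first.
    rewrite inE negb_or !memNfinsupp => /andP[/eqP-> /eqP->].
    exact: subrr.
  apply: (indep A (fun g => u g - v g)) => // [|h|].
  - exact: fset_uniq.
  - exact: RB.
  by rewrite sumrB -!sum_map_widen ?fsubsetUl ?fsubsetUr // uv subrr.
have [s [d [Rd ->]]] := gen x.
have [u sum_u uE] := collect_by_degree s d id.
exists u => //; split=> // g; rewrite uE big_seq_cond.
elim/big_ind: _ => // [y z|y /andP[/Rd + /eqP<-] //].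
exact: RD.
Qed.

(** A grading coarsens another one along [f] as soon as [f] tells, for each
    finer piece, a coarser piece containing it: the reverse inclusions come
    for free because the coarser sum is direct. *)
Lemma is_coarseningP (R : pzRingType) (G H : zmodType) (R_ : G -> set R)
    (S_ : H -> set R) (f : G -> H) :
    is_grading R_ -> is_grading S_ ->
  is_coarsening R_ S_ f <-> (forall g x, R_ g x -> S_ (f g) x).
Proof.
move=> gradR gradS; split=> [coarse g x Rx | RS h].
  rewrite coarse.
  have [u sum_u uE] := collect_by_degree [:: tt] (fun=> g) (fun=> x).
  exists u; last by rewrite sum_u big_seq1.
  split=> [k|k /=].
    by rewrite uE; apply: (grading_sum gradR) => i /eqP <-.
  rewrite mem_finsupp uE big_mkcond big_seq1 /=.
  by case: (g =P k) => [->|_] //; rewrite eqxx.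
apply/seteqP; split=> [x Sx|_ [u [Ru fu] <-]]; last first.
  rewrite /sum_map big_seq; apply: (grading_sum gradS) => g gu.
  by rewrite -(fu g gu); apply: RS.
have [s [c [_ Rc x_sum]]] := grading_decomposition gradR x.
have [u sum_u uE] := collect_by_degree [seq g <- s | f g == h] id c.
have Sc g : S_ (f g) (c g) by apply: RS.
exists u; last first.
  rewrite sum_u big_filter.
  by rewrite (grading_component gradS Sc Sx (esym x_sum)) eqxx.
split=> g; first by rewrite uE; apply: (grading_sum gradR) => i /eqP <-.
rewrite /= mem_finsupp uE big_filter_cond => nz_ug.
apply: contrapT => fg; move: nz_ug; rewrite big_pred0 ?eqxx // => i.
by apply/negP => /andP[/eqP fi /eqP ig]; apply: fg; rewrite -ig.
Qed.

(** * The universal grading of a ring with many homogeneous elements *)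

Section UniversalGrading.
Variable R : comNzRingType.

Definition always_homogeneous (x : R) : Prop :=
  forall (H : zmodType) (S_ : H -> set R), is_grading S_ -> exists h, S_ h x.

Definition same_degree (x y : R) : Prop :=
  forall (H : zmodType) (S_ : H -> set R), is_grading S_ ->
  forall h, S_ h x <-> S_ h y.

Hypothesis dom : forall x y : R, x * y = 0 -> x = 0 \/ y = 0.

Lemma mul_neq0 (x y : R) : x <> 0 -> y <> 0 -> x * y <> 0.
Proof. by move=> x0 y0 /dom[]. Qed.

(** One implication suffices: an always homogeneous [x] has some degree, and a
    nonzero [y] can have no degree other than that one. *)
Lemma same_degreeW (x y : R) :
    x <> 0 -> y <> 0 -> always_homogeneous x ->
    (forall (H : zmodType) (S_ : H -> set R), is_grading S_ ->
      forall h, S_ h x -> S_ h y) ->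
  same_degree x y.
Proof.
move=> x0 y0 homx xy H S_ gradS h; split=> [|Sy]; first exact: xy.
have [k Sx] := homx H S_ gradS.
by rewrite -(grading_degree_unique gradS (xy H S_ gradS k Sx) Sy y0).
Qed.

Lemma always_homogeneousM (x y : R) :
  always_homogeneous x -> always_homogeneous y -> always_homogeneous (x * y).
Proof.
move=> homx homy H S_ gradS.
have [[h Sx] [k Sy]] := (homx H S_ gradS, homy H S_ gradS).
by exists (h + k); apply: (grading_mul gradS).
Qed.

Lemma same_degreeM (x y x' y' : R) :
    x <> 0 -> y <> 0 -> x' <> 0 -> y' <> 0 ->
    always_homogeneous x -> always_homogeneous y ->
    same_degree x x' -> same_degree y y' -> same_degree (x * y) (x' * y').
Proof.
move=> x0 y0 x'0 y'0 homx homy xx' yy'.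
apply: same_degreeW; do ?[exact: mul_neq0|exact: always_homogeneousM].
move=> H S_ gradS l Sxy.
have [[h Sx] [k Sy]] := (homx H S_ gradS, homy H S_ gradS).
have Sxy' := grading_mul gradS Sx Sy.
rewrite (grading_degree_unique gradS Sxy Sxy' (mul_neq0 x0 y0)).
by apply: (grading_mul gradS); [rewrite -xx'|rewrite -yy'].
Qed.

Lemma always_homogeneous1 : always_homogeneous 1.
Proof. by move=> H S_ gradS; exists 0; apply: grading1. Qed.

Lemma always_homogeneousX (x : R) n :
  always_homogeneous x -> always_homogeneous (x ^+ n).
Proof.
by move=> homx H S_ /[dup] /homx[h Sx] gradS; exists (h *+ n); apply: gradingX.
Qed.

Lemma exp_neq0 (x : R) n : x <> 0 -> x ^+ n <> 0.
Proof.
move=> x0; elim: n => [|n IHn]; first by apply/eqP; rewrite expr0 oner_neq0.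
by rewrite exprS; apply: mul_neq0.
Qed.

Hypothesis torsion : forall x : R, x <> 0 -> exists2 m, (0 < m)%N &
  forall (H : zmodType) (S_ : H -> set R) h, is_grading S_ -> S_ h x ->
  h *+ m = 0.

(** The nonzero always homogeneous elements form a monoid, and having the same
    degrees is a congruence on it. The quotient is a group because degrees are
    torsion: if [m] kills all the degrees of [x], then [x ^+ m.-1] represents
    the inverse of the class of [x]. *)
Lemma degree_group_exists :
  exists (G : zmodType) (dg : R -> G),
    [/\ forall x y, always_homogeneous x -> always_homogeneous y ->
          x <> 0 -> y <> 0 -> dg x = dg y <-> same_degree x y,
        forall x y, always_homogeneous x -> always_homogeneous y ->
          x <> 0 -> y <> 0 -> dg (x * y) = dg x + dg y
      & forall g, exists x, [/\ always_homogeneous x, x <> 0 & dg x = g]].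
Proof.
pose T := {x : R | `[< always_homogeneous x /\ x <> 0 >]}.
have homT (t : T) : always_homogeneous (val t) by have /asboolP[] := valP t.
have nzT (t : T) : val t <> 0 by have /asboolP[] := valP t.
have toT x : always_homogeneous x -> x <> 0 -> {t : T | val t = x}.
  move=> homx x0; have Tx : `[< always_homogeneous x /\ x <> 0 >].
    by apply/asboolP.
  by exists (exist _ x Tx).
pose e : rel T := fun s t => `[< same_degree (val s) (val t) >].
have e_refl : reflexive e by move=> s; apply/asboolP.
have e_sym : symmetric e.
  by move=> s t; apply/asboolP/asboolP => st H S_ gradS h; rewrite st.
have e_trans : transitive e.
  move=> t s u /asboolP st /asboolP tu; apply/asboolP => H S_ gradS h.
  by rewrite st // tu.
pose eE := EquivRel e e_refl e_sym e_trans.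
pose Q := {eq_quot eE}.
have piE (s t : T) : (\pi_Q s = \pi_Q t) <-> same_degree (val s) (val t).
  split=> [/eqP|st]; first by rewrite eqmodE => /asboolP.
  by apply/eqP; rewrite eqmodE; apply/asboolP.
have reprE (t : T) : same_degree (val (repr (\pi_Q t))) (val t).
  by apply/piE; rewrite reprK.
have same_refl x : same_degree x x by [].
have [mul mulE] : {mul : T -> T -> T |
    forall s t, val (mul s t) = val s * val t}.
  exists (fun s t => sval (toT _ (always_homogeneousM (homT s) (homT t))
    (mul_neq0 (nzT s) (nzT t)))) => s t.
  exact: svalP (toT _ _ _).
have [exp expE] : {exp : T -> nat -> T |
    forall t n, val (exp t n) = val t ^+ n}.
  exists (fun t n => sval (toT _ (always_homogeneousX n (homT t))
    (exp_neq0 (n := n) (nzT t)))) => t n.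
  exact: svalP (toT _ _ _).
have [one oneE] := toT _ always_homogeneous1 (elimN eqP (oner_neq0 R)).
have ordP (t : T) : {m | (0 < m)%N & forall (H : zmodType) (S_ : H -> set R) h,
    is_grading S_ -> S_ h (val t) -> h *+ m = 0}.
  exact: cid2 (torsion (nzT t)).
pose oppQ (q : Q) : Q :=
  \pi_Q (exp (repr q) (s2val (ordP (repr q))).-1).
pose zeroQ : Q := \pi_Q one.
have [addQ addQE] : {addQ : Q -> Q -> Q |
    forall s t, addQ (\pi_Q s) (\pi_Q t) = \pi_Q (mul s t)}.
  exists (fun q r => \pi_Q (mul (repr q) (repr r))) => s t.
  apply/piE; rewrite !mulE.
  by apply: same_degreeM; do ?[exact: nzT|exact: homT|exact: reprE].
have addQA : associative addQ.
  elim/quotW=> q; elim/quotW=> r; elim/quotW=> s; rewrite !addQE.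
  apply/piE; rewrite !mulE mulrA. by apply: same_refl.
have addQC : commutative addQ.
  elim/quotW=> q; elim/quotW=> r; rewrite !addQE.
  by apply/piE; rewrite !mulE mulrC; apply: same_refl.
have add0Q : left_id zeroQ addQ.
  elim/quotW=> q; rewrite addQE.
  by apply/piE; rewrite !mulE oneE mul1r; apply: same_refl.
have addNQ : left_inverse zeroQ oppQ addQ.
  move=> q; rewrite -{2}[q]reprK addQE; apply/piE.
  rewrite mulE expE oneE.
  case: (ordP _) => /= m m0 ord_m; rewrite -exprSr prednK //.
  apply: same_degreeW.
  - exact/exp_neq0/nzT.
  - exact/eqP/oner_neq0.
  - exact/always_homogeneousX/homT.
  move=> H S_ gradS h; have [k Sq] := homT (repr q) H S_ gradS => Sqm.
  have Sqm' := gradingX gradS dom m Sq.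
  rewrite (grading_degree_unique gradS Sqm Sqm' (exp_neq0 (nzT _))).
  by rewrite (ord_m H S_ k gradS Sq); apply: grading1.
pose Qz := GRing.isZmodule.Build Q addQA addQC add0Q addNQ.
pose G : zmodType := HB.pack Q Qz.
pose dg (x : R) : G := if insub x is Some t then \pi_Q t else zeroQ.
have dgE (t : T) : dg (val t) = \pi_Q t by rewrite /dg valK.
exists G, dg; split.
- move=> x y homx homy x0 y0.
  have [[s <-] [t <-]] := (toT x homx x0, toT y homy y0).
  by rewrite !dgE; apply: piE.
- move=> x y homx homy x0 y0.
  have [[s <-] [t <-]] := (toT x homx x0, toT y homy y0).
  by rewrite -mulE !dgE -addQE.
- move=> g; exists (val (repr (g : Q))); split; [exact: homT|exact: nzT|].
  by rewrite dgE reprK.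
Qed.

Hypothesis generated : forall x : R, exists2 s : seq R,
  (forall y, y \in s -> always_homogeneous y) & x = \sum_(y <- s) y.

(** The piece of degree [g] consists of 0 and of the always homogeneous elements
    of class [g]: it is closed under addition, because elements of the same
    class lie in the same piece of every grading and hence so does their sum. *)
Theorem universal_grading_exists : has_universal_grading R.
Proof.
have [G [dg [dgP dgM dg_surj]]] := degree_group_exists.
pose R_ (g : G) : set R := fun x => x = 0 \/ always_homogeneous x /\ dg x = g.
have homR g x : R_ g x -> always_homogeneous x.
  by case=> [->|[]] // H S_ gradS; exists 0; apply: grading0.
have transfer g x y (H : zmodType) (S_ : H -> set R) h :
    is_grading S_ -> R_ g x -> R_ g y -> x <> 0 -> S_ h x -> S_ h y.
  move=> gradS [//|[homx dgx]] Ry x0 Sx; have [->|/eqP y0] := eqVneq y 0.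
    exact: grading0.
  case: Ry => // -[homy dgy].
  have xy : same_degree x y by apply/dgP => //; rewrite dgx dgy.
  exact: (xy H S_ gradS h).1.
have R0 g : R_ g 0 by left.
have RB g x y : R_ g x -> R_ g y -> R_ g (x - y).
  move=> Rx Ry; have [|/eqP xy0] := eqVneq (x - y) 0; first by left.
  have [z [homz z0 dgz]] := dg_surj g; have Rz : R_ g z by right.
  have zxy (H : zmodType) (S_ : H -> set R) : is_grading S_ ->
      forall h, S_ h z -> S_ h (x - y).
    by move=> gradS h Sz; apply: gradingB; rewrite //; apply: (transfer g z) Sz.
  have homxy : always_homogeneous (x - y).
    move=> H S_ gradS; have [h Sz] := homz H S_ gradS.
    by exists h; apply: zxy Sz.
  right; split=> //; rewrite -dgz; apply/esym/dgP => //.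
  exact: same_degreeW homz zxy.
have RM g g' x y : R_ g x -> R_ g' y -> R_ (g + g') (x * y).
  move=> [->|[homx <-]]; first by rewrite mul0r; left.
  move=> [->|[homy <-]]; first by rewrite mulr0; left.
  have [->|/eqP x0] := eqVneq x 0; first by rewrite mul0r; left.
  have [->|/eqP y0] := eqVneq y 0; first by rewrite mulr0; left.
  by right; split; [exact: always_homogeneousM|exact: dgM].
have indep (s : seq G) (c : G -> R) : uniq s -> (forall g, R_ g (c g)) ->
    \sum_(g <- s) c g = 0 -> forall g, g \in s -> c g = 0.
  move=> + Rc; have [n] := ubnP (size s); elim: n s => // n IHn s.
  rewrite ltnS => ltn us s0 g gs; apply: contrapT => cg0.
  have [g' [g's g'g cg'0]] : exists g', [/\ g' \in s, g' <> g & c g' <> 0].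
    apply: contrapT => none; apply: cg0; rewrite -[RHS]s0 (bigD1_seq g) //=.
    rewrite big_seq_cond big1 ?addr0 // => g' /andP[g's /eqP g'g].
    by apply: contrapT => cg'0; apply: none; exists g'.
  have ndeg : ~ same_degree (c g) (c g').
    move/(dgP _ _ (homR _ _ (Rc g)) (homR _ _ (Rc g')) cg0 cg'0).2 => dgg.
    case: (Rc g) (Rc g') => [//|[_ dgg1]] [//|[_ dgg2]]; apply: g'g.
    by rewrite -dgg1 -dgg2.
  (* A grading separating [c g] from [c g'] splits the relation into shorter
     ones. *)
  apply: ndeg; apply: same_degreeW => // [|H S_ gradS h Sg].
    exact: homR (Rc g).
  have /choice[d Sd] : forall k, exists l, S_ l (c k).
    by move=> k; apply: homR (Rc k) H S_ gradS.
  have dgh : d g = h := grading_degree_unique gradS (Sd g) Sg cg0.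
  apply: contrapT => nSg'; apply: cg0.
  have dg'h : d g' != h by apply/eqP => dg'; apply: nSg'; rewrite -dg'.
  apply: (IHn [seq k <- s | d k == h]); rewrite ?filter_uniq //.
  - rewrite (leq_trans _ ltn) // size_filter.
    rewrite -(count_predC (fun k => d k == h) s) -[X in (X < _)%N]addn0.
    by rewrite ltn_add2l -has_count; apply/hasP; exists g'.
  - by rewrite big_filter; exact: (grading_component_eq0 gradS Sd s0).
  - by rewrite mem_filter gs dgh eqxx.
have gradR : is_grading R_.
  apply: grading_intro => // x; have [s homs ->] := generated x.
  by exists s, dg; split=> // y /homs homy; right.
exists G, R_; split=> // H S_ gradS.
have /choice[f RS] : forall g, exists h, forall x, R_ g x -> S_ h x.
  move=> g; have [t [homt t0 dgt]] := dg_surj g.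
  have [h St] := homt H S_ gradS; exists h => x Rx.
  by apply: transfer gradS _ Rx t0 St; right.
have fD : {morph f : g g' / g + g'}.
  move=> g g'; have [t [homt t0 dgt]] := dg_surj g.
  have [t' [homt' t'0 dgt']] := dg_surj g'.
  have Rt : R_ g t by right.
  have Rt' : R_ g' t' by right.
  apply: (@grading_degree_unique R H S_ gradS _ _ (t * t')).
  - exact/RS/RM.
  - by apply: grading_mul gradS _ _ _ _ _ _; apply: RS.
  - exact: mul_neq0.
have fB : zmod_morphism f.
  by move=> g g'; apply: (addIr (f g')); rewrite -fD !subrK.
pose fM := GRing.isZmodMorphism.Build G H f fB.
pose fA : {additive G -> H} := HB.pack f fM.
exists fA; first by apply/is_coarseningP.
move=> f' /(is_coarseningP _ gradR gradS) RS' g.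
have [t [homt t0 dgt]] := dg_surj g.
have Rt : R_ g t by right.
exact: (grading_degree_unique gradS (RS' g t Rt) (RS g t Rt) t0).
Qed.

End UniversalGrading.

(** * The mean square norm of an algebraic number *)

Lemma galois_char0 (F : fieldType) (L : splittingFieldType F)
    (K : {subfield L}) : [pchar F] =i pred0 -> galois K {:L}.
Proof.
move=> F0; rewrite /galois subvf normalFieldf andbT /=.
apply/separableP => x _; apply: pcharf0_separable => p.
by rewrite pchar_lalg.
Qed.

(** Adjoining all the conjugates of the elements of [s] makes the field
    normal. *)
Lemma splitting_number_field (s : seq algC) :
  exists (L : splittingFieldType rat) (iota : {rmorphism L -> algC}),
    forall x, x \in s -> exists k, iota k = x.
Proof.
pose P := \prod_(x <- s) minCpoly x.
have [p Dp] : exists p : {poly rat}, P = map_poly ratr p.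
  rewrite /P; elim: s {P} => [|x s [p IHs]].
    by exists 1; rewrite big_nil rmorph1.
  have [q [Dq _] _] := minCpolyP x.
  by exists (q * p); rewrite big_cons IHs Dq rmorphM.
have monP : P \is monic by apply: monic_prod => x _; apply: minCpoly_monic.
have [r Dr] := closed_field_poly_normal P.
rewrite (monicP monP) scale1r in Dr.
have [Qs [QsC [r1 Dr1 gen]]] := num_field_exists r.
have axQs : splitting_field_axiom Qs.
  exists (\prod_(z <- r1) ('X - z%:P)); last by exists r1; first exact: eqpxx.
  suff -> : \prod_(z <- r1) ('X - z%:P) = map_poly (in_alg Qs) p.
    by apply/polyOverP => i; rewrite coef_map; apply/vlineP; exists p`_i.
  apply: (map_poly_inj QsC).
  rewrite rmorph_prod /= -map_poly_comp.
  rewrite (@eq_map_poly _ _ _ ratr) => [|a]; last first.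
    by rewrite /= alg_num_field fmorph_rat.
  rewrite -Dp Dr -Dr1 big_map; apply: eq_bigr => z _.
  by rewrite rmorphB /= map_polyX map_polyC.
pose L : splittingFieldType rat :=
  HB.pack (FieldExt.sort Qs)
    (FieldExt_isSplittingField.Build rat Qs axQs).
exists L, QsC => x xs.
have : x \in r.
  rewrite -root_prod_XsubC -Dr /P (perm_big _ (perm_to_rem xs)) big_cons /=.
  by rewrite rootM root_minCpoly.
by rewrite -Dr1 => /mapP[k _ ->]; exists k.
Qed.

Definition conjugates (x : algC) : seq algC :=
  sval (closed_field_poly_normal (minCpoly x)).

Lemma minCpoly_conjugates x :
  minCpoly x = \prod_(z <- conjugates x) ('X - z%:P).
Proof.
rewrite /conjugates; case: closed_field_poly_normal => /= r.
by rewrite (monicP (minCpoly_monic x)) scale1r.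
Qed.

(** Normalised by the number of conjugates, so that it can be computed in any
    Galois number field containing [x]; see [sum_sqnorm_gal]. *)
Definition mean_sqnorm (x : algC) : algC :=
  (\sum_(z <- conjugates x) `|z| ^+ 2) / (size (conjugates x))%:R.

Lemma size_conjugates_gt0 x : (0 < size (conjugates x))%N.
Proof.
by have := size_minCpoly x; rewrite minCpoly_conjugates size_prod_XsubC.
Qed.

Lemma mean_sqnorm_ge0 x : 0 <= mean_sqnorm x.
Proof. by apply: divr_ge0 => //; apply: sumr_ge0 => z _; apply: exprn_ge0. Qed.

Section NumberField.
Variables (L : splittingFieldType rat) (iota : {rmorphism L -> algC}).
Local Notation Gal := 'Gal({:L} / 1)%g.

Lemma galois_rat (K : {subfield L}) : galois K {:L}.
Proof. by apply: galois_char0; apply: pchar_num. Qed.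

Lemma iota_alg a : iota (a%:A) = ratr a.
Proof. by rewrite alg_num_field fmorph_rat. Qed.

Lemma map_minPoly1 k : map_poly iota (minPoly 1 k) = minCpoly (iota k).
Proof.
have [q [Dq monq] minq] := minCpolyP (iota k).
have ratP (p : {poly rat}) :
    map_poly ratr p = map_poly iota (map_poly (in_alg L) p).
  by rewrite -map_poly_comp; apply: eq_map_poly => a /=; rewrite iota_alg.
have [p Dp] : exists p : {poly rat}, minPoly 1 k = map_poly (in_alg L) p.
  have /polyOverP cP := minPolyOver 1 k.
  have /choice[a Da] i : exists a, (minPoly 1 k)`_i = a%:A.
    by have /vlineP := cP i.
  exists (\poly_(i < size (minPoly 1 k)) a i).
  apply/polyP => i; rewrite coef_map coef_poly /=.
  by case: ltnP => [_|/leq_sizeP ->]; rewrite ?Da ?scale0r.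
apply/eqP; rewrite -eqp_monic ?minCpoly_monic ?map_monic ?monic_minPoly //.
rewrite Dq; apply/andP; split.
  rewrite ratP dvdp_map minPoly_dvdp //.
    by apply/polyOverP => i; rewrite coef_map; apply/vlineP; exists q`_i.
  by rewrite -(fmorph_root iota) -ratP -Dq root_minCpoly.
rewrite Dp -ratP dvdp_map -minq ratP -Dp fmorph_root.
exact: root_minPoly.
Qed.

Lemma sum_gal_translate (K : {subfield L}) (rho : gal_of {:L})
    (f : gal_of {:L} -> algC) :
    rho \in 'Gal({:L} / K)%g ->
  \sum_(sigma in Gal) f (rho * sigma)%g = \sum_(sigma in Gal) f sigma.
Proof.
move=> Krho; have Grho : rho \in Gal.
  by apply: (fintype.subsetP (galS _ (sub1v K))) Krho.
rewrite [RHS](reindex_inj (mulgI rho)) /=; apply: eq_bigl => sigma.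
by rewrite groupMl.
Qed.

(** Let [r] list automorphisms whose values at [k] are the conjugates of [k],
    each once. Summing over all pairs of [rho] in [r] and [sigma] in the Galois
    group gives [size r] copies of the left-hand side when [rho] is fixed, by
    translation, and [#|Gal|] copies of the sum over conjugates when [sigma] is
    fixed, since [sigma] permutes them. *)
Lemma sum_sqnorm_gal k :
  \sum_(sigma in Gal) `|iota (sigma k)| ^+ 2 =
  #|Gal|%:R * mean_sqnorm (iota k).
Proof.
have [r [rG _ Dr]] := galois_factors (sub1v _) (galois_rat 1) k (memvf k).
have Dconj (sigma : gal_of {:L}) : sigma \in Gal ->
    perm_eq (conjugates (iota k))
      [seq iota (sigma (rho k)) | rho : gal_of {:L} <- r].
  move=> Gsigma; apply: prod_XsubC_eq; rewrite -minCpoly_conjugates.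
  rewrite -map_minPoly1.
  have <- : map_poly sigma (minPoly 1 k) = minPoly 1 k.
    apply/polyP => i; rewrite coef_map; apply: (fixed_gal (sub1v _) Gsigma).
    exact/polyOverP/minPolyOver.
  rewrite Dr !big_map !rmorph_prod /=; apply: eq_bigr => rho _.
  by rewrite !rmorphB /= !map_polyX !map_polyC.
have sz_r : size (conjugates (iota k)) = size r.
  by rewrite (perm_size (Dconj 1%g (group1 _))) size_map.
have n0 : (size r)%:R != 0 :> algC.
  by rewrite pnatr_eq0 -lt0n -sz_r size_conjugates_gt0.
apply: (mulfI n0); rewrite /mean_sqnorm sz_r mulrCA.
rewrite [X in _ = _ * X]mulrC divfK //.
transitivity (\sum_(rho <- r) \sum_(sigma in Gal) `|iota (sigma (rho k))| ^+ 2).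
  rewrite big_seq.
  rewrite (eq_bigr (fun=> \sum_(sigma in Gal) `|iota (sigma k)| ^+ 2)).
    by rewrite -big_seq big_const_seq count_predT iter_addr_0 mulr_natl.
  move=> rho /(fintype.subsetP rG) Grho.
  rewrite -(sum_gal_translate (fun sigma => `|iota (sigma k)| ^+ 2) Grho).
  by apply: eq_bigr => sigma _; rewrite galM ?memvf.
rewrite exchange_big /=.
rewrite (eq_bigr (fun=> \sum_(z <- conjugates (iota k)) `|z| ^+ 2)).
  by rewrite sumr_const mulr_natl.
by move=> sigma Gsigma; rewrite (perm_big _ (Dconj sigma Gsigma)) /= big_map.
Qed.

(** By the inequality between arithmetic and geometric means: the product of
    the squares over the Galois group is the square of the norm of [k], a
    nonzero rational integer. *)
Lemma mean_sqnorm_ge1_gal k :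
  iota k \in Aint -> k != 0 -> 1 <= mean_sqnorm (iota k).
Proof.
move=> intk k0; pose n := #|Gal|.
have n_gt0 : (0 < n)%N by apply: cardG_gt0.
have intsk (sigma : gal_of {:L}) : sigma \in Gal -> iota (sigma k) \in Aint.
  move=> Gsigma; apply: (@root_monic_Aint (minCpoly (iota k))) => //.
    rewrite -map_minPoly1 fmorph_root root_minPoly_gal ?sub1v ?memvf //.
  exact: minCpoly_monic.
pose N := galNorm 1 {:L} k.
have DN : iota N = \prod_(sigma in Gal) iota (sigma k) by rewrite rmorph_prod.
have Nint : iota N \in Num.int.
  apply: Cint_rat_Aint; last by rewrite DN; apply: rpred_prod.
  have : N \in 1%VS.
    rewrite -(galois_fixedField (galois_rat 1)).
    by apply: galNorm_fixedField; apply: memvf.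
  by move=> /vlineP[a ->]; rewrite iota_alg Crat_rat.
have N0 : iota N != 0.
  rewrite fmorph_eq0; apply/prodf_neq0 => sigma _.
  by rewrite fmorph_eq0.
have := @leif_AGM _ _ (mem Gal) (fun sigma => `|iota (sigma k)| ^+ 2).
case=> [sigma _|le_AGM _]; first exact: exprn_ge0.
have n0 : n%:R != 0 :> algC by rewrite pnatr_eq0 -lt0n.
rewrite sum_sqnorm_gal -/n [_ / _]mulrC mulKf // in le_AGM.
have ge1 : 1 <= mean_sqnorm (iota k) ^+ n.
  apply: le_trans le_AGM; rewrite prodrXl -normr_prod -DN.
  by rewrite exprn_ege1 // norm_intr_ge1.
by rewrite expr_ge1 ?mean_sqnorm_ge0 in ge1.
Qed.

End NumberField.

(** * Rings of algebraic integers *)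

Section IntegralSubring.
Variables (R : comNzRingType) (phi : {rmorphism R -> algC}).
Hypothesis phi_inj : injective phi.

Lemma phi_eq0 (x : R) : phi x = 0 -> x = 0.
Proof. by move=> x0; apply: phi_inj; rewrite x0 rmorph0. Qed.

Lemma phi_dom (x y : R) : x * y = 0 -> x = 0 \/ y = 0.
Proof.
move=> xy0; have /eqP : phi x * phi y = 0 by rewrite -rmorphM xy0 rmorph0.
by rewrite mulf_eq0 => /orP[] /eqP/phi_eq0; [left|right].
Qed.

Section Grading.
Variables (H : zmodType) (S_ : H -> set R).
Hypothesis gradS : is_grading S_.
Variables (L : splittingFieldType rat) (iota : {rmorphism L -> algC}).

(** Minimal polynomials have coefficients in a field, where no grading is given;
    those of interest return to the degree-zero part of the ring on clearing
    an integer denominator. *)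
Definition deg0_fraction (c : L) : Prop :=
  exists n r, [/\ (0 < n)%N, S_ 0 r & iota c *+ n = phi r].

Lemma common_denominator (c : nat -> L) n :
    (forall i, deg0_fraction (c i)) ->
  exists N r, [/\ (0 < N)%N, forall i, S_ 0 (r i)
    & forall i, (i < n)%N -> iota (c i) *+ N = phi (r i)].
Proof.
move=> cP; elim: n => [|n [N [r [N0 Sr rE]]]].
  by exists 1%N, (fun=> 0); split=> // i; apply: grading0.
have [m [s [m0 Ss sE]]] := cP n.
exists (N * m)%N, (fun i => if i == n then s *+ N else r i *+ m).
split=> [|i|i]; first by rewrite muln_gt0 N0.
  by case: ifP => _; apply: grading_natmul.
rewrite ltnS leq_eqVlt; case: eqP => [-> _|_ /= /rE ri].
  by rewrite mulnC mulrnA sE rmorphMn.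
by rewrite mulrnA ri rmorphMn.
Qed.

Lemma deg0_fractionD (c d : L) :
  deg0_fraction c -> deg0_fraction d -> deg0_fraction (c + d).
Proof.
move=> [n [r [n0 Sr rE]]] [m [s [m0 Ss sE]]].
exists (n * m)%N, (r *+ m + s *+ n); rewrite muln_gt0 n0; split=> //.
  by apply: gradingD => //; apply: grading_natmul.
by rewrite rmorphD mulrnDl rmorphD !rmorphMn -rE -sE -!mulrnA [(m * n)%N]mulnC.
Qed.

Lemma deg0_fractionM (c d : L) :
  deg0_fraction c -> deg0_fraction d -> deg0_fraction (c * d).
Proof.
move=> [n [r [n0 Sr rE]]] [m [s [m0 Ss sE]]].
exists (n * m)%N, (r * s); rewrite muln_gt0 n0; split=> //.
  by rewrite -[0]addr0; apply: (grading_mul gradS).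
by rewrite !rmorphM -rE -sE mulrnAl mulrnAr -mulrnA mulnC.
Qed.

Lemma deg0_fraction_rat (a : rat) : deg0_fraction a%:A.
Proof.
exists `|denq a|%N, (numq a)%:~R; split; first by rewrite absz_gt0 denq_neq0.
  by apply: grading_intmul => //; apply: grading1 => //; apply: phi_dom.
rewrite iota_alg rmorph_int -mulr_natr -[in RHS](rmorph_int ratr).
rewrite -[X in _ * X = _](rmorph_nat ratr) -rmorphM /=; congr ratr.
rewrite pmulrn absz_denq -[a in a * _]divq_num_den divfK //.
by rewrite intr_eq0 denq_neq0.
Qed.

Lemma deg0_fraction_Fadjoin (w c : L) (w0 : R) :
  S_ 0 w0 -> iota w = phi w0 -> c \in <<1; w>>%VS -> deg0_fraction c.
Proof.
move=> Sw Dw /Fadjoin_polyP[p /polyOverP pQ ->].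
have fw : deg0_fraction w by exists 1%N, w0.
have fwX n : deg0_fraction (w ^+ n).
  elim: n => [|n IHn].
    by rewrite expr0 -[1]scale1r; apply: deg0_fraction_rat.
  by rewrite exprS; apply: deg0_fractionM.
rewrite horner_coef; elim/big_ind: _ => [||i _]; last 1 first.
- apply: deg0_fractionM => //.
  by have /vlineP[a ->] := pQ i; apply: deg0_fraction_rat.
- by rewrite -(scale0r 1); apply: deg0_fraction_rat.
- exact: deg0_fractionD.
Qed.

(** Let [t] be homogeneous of degree [delta != 0] and let [p] be its minimal
    polynomial, of degree [e], over a field generated in degree zero. The part
    of the relation [p.[t] = 0] in degree [e * delta] is again such a relation
    with the same leading term, so it is [p] itself; in it the term in
    [t ^+ e.-1] is missing. *)
Lemma minPoly_subleading_eq0 (w t : L) (w0 t0 : R) delta :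
    S_ 0 w0 -> iota w = phi w0 -> S_ delta t0 -> iota t = phi t0 ->
    delta != 0 ->
  (minPoly <<1; w>>%AS t)`_(size (minPoly <<1; w>>%AS t)).-2 = 0.
Proof.
move=> Sw Dw St Dt delta0; set F := <<1; w>>%AS; set p := minPoly F t.
have monp : p \is monic := monic_minPoly F t.
have pF : p \is a polyOver F := minPolyOver F t.
have pt0 : p.[t] = 0 by apply/eqP; apply: root_minPoly.
pose e := (size p).-1.
have sz_p : size p = e.+1 by rewrite /e /p size_minPoly.
have e_gt0 : (0 < e)%N.
  by have := root_size_gt1 (monic_neq0 monp) (root_minPoly F t); rewrite sz_p.
have fracp i : deg0_fraction p`_i.
  by apply: (deg0_fraction_Fadjoin Sw Dw); apply: (polyOverP pF).
have [N [r [N0 Sr rE]]] := common_denominator (size p) fracp.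
have rel0 : \sum_(i < size p) r i * t0 ^+ i = 0.
  apply: phi_eq0; rewrite rmorph_sum /=.
  rewrite (eq_bigr (fun i : 'I_(size p) => iota (p`_i * t ^+ i) *+ N)).
    by rewrite sumrMnl -rmorph_sum -horner_coef pt0 rmorph0 mul0rn.
  by move=> i _; rewrite !rmorphM !rmorphXn /= Dt -(rE i) // mulrnAl.
have Srt (i : 'I_(size p)) : S_ (delta *+ i) (r i * t0 ^+ i).
  rewrite -[delta *+ i]add0r; apply: (grading_mul gradS) => //.
  by apply: gradingX => //; apply: phi_dom.
have rel_e := grading_component_eq0 gradS Srt rel0 (delta *+ e).
pose q := \poly_(i < size p) (if delta *+ i == delta *+ e then p`_i else 0).
have qt0 : q.[t] = 0.
  rewrite horner_poly; apply: (fmorph_inj iota); rewrite rmorph0.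
  have N0' : N%:R != 0 :> algC by rewrite pnatr_eq0 -lt0n.
  apply: (mulIf N0'); rewrite mul0r mulr_natr.
  rewrite -(rmorph0 phi) -rel_e rmorph_sum rmorph_sum /= -sumrMnl.
  rewrite [RHS]big_mkcond /=.
  apply: eq_bigr => i _; case: ifP => _; last by rewrite mul0r rmorph0 mul0rn.
  by rewrite !rmorphM !rmorphXn /= Dt -(rE i) // mulrnAl.
have pq : p - q = 0.
  apply/eqP; apply: contraTT isT => nz_pq.
  have pqF : p - q \is a polyOver F.
    rewrite rpredB //; apply/polyOverP => i; rewrite coef_poly.
    by do 2?case: ifP => _; rewrite ?rpred0 //; apply: (polyOverP pF).
  have : root (p - q) t by rewrite /root hornerD hornerN pt0 qt0 subrr.
  move=> /(minPoly_dvdp pqF) /(dvdp_leq nz_pq); rewrite -/p leqNgt => /negP[].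
  rewrite sz_p ltnS; apply/leq_sizeP => j; rewrite leq_eqVlt coefB coef_poly.
  case/orP=> [/eqP<-|ej]; first by rewrite sz_p ltnSn eqxx subrr.
  by rewrite sz_p ltnS leqNgt ej /= subr0; apply/leq_sizeP: ej; rewrite sz_p.
have -> : p = q by apply/eqP; rewrite -subr_eq0 pq.
have -> : size q = size p by rewrite -[in RHS](subrK q p) pq add0r.
rewrite sz_p /= coef_poly; case: ifP => // _; case: ifP => // /eqP.
case: e e_gt0 {sz_p rel_e q qt0 pq} => // e _ /=; rewrite mulrSr => /esym.
by rewrite -[RHS]addr0 => /addrI /eqP; rewrite (negPf delta0).
Qed.

(** Orthogonality comes from vanishing traces. Writing
    [w = v ^+ m], of degree zero, and [t = u * v ^+ m.-1], each term of the sum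
    is [sigma t] times a factor depending on [sigma] only through its
    restriction to the field generated by [w], as the absolute value of
    [sigma v] is determined by [sigma w]. Grouping the terms according to that
    restriction produces traces of [t], which vanish. *)
Lemma homogeneous_orthogonal (u v : R) g h m (ku kv : L) :
    S_ g u -> S_ h v -> g != h -> (0 < m)%N -> h *+ m = 0 ->
    iota ku = phi u -> iota kv = phi v ->
  \sum_(sigma in 'Gal({:L} / 1)%g) iota (sigma ku) * (iota (sigma kv))^* = 0.
Proof.
case: m => // m Su Sv gh _ hm Du Dv.
have [->|kv0] := eqVneq kv 0.
  by rewrite big1 // => sigma _; rewrite !rmorph0 mulr0.
pose w := kv ^+ m.+1; pose t := ku * kv ^+ m; pose F := <<1; w>>%AS.
have Sw : S_ 0 (v ^+ m.+1).
  by rewrite -hm; apply: gradingX => //; apply: phi_dom.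
have Dw : iota w = phi (v ^+ m.+1) by rewrite !rmorphXn Dv.
have St : S_ (g + h *+ m) (u * v ^+ m).
  by apply: (grading_mul gradS) => //; apply: gradingX => //; apply: phi_dom.
have Dt : iota t = phi (u * v ^+ m) by rewrite !rmorphM !rmorphXn Du Dv.
have delta0 : g + h *+ m != 0.
  apply: contra gh => /eqP ghm; apply/eqP.
  by apply: (addIr (h *+ m)); rewrite ghm -mulrS.
have sub0 := minPoly_subleading_eq0 Sw Dw St Dt delta0.
have [r [rF _ Dr]] := galois_factors (subvf F) (galois_rat F) t (memvf t).
have sz_r : (0 < size r)%N.
  have := root_size_gt1 (monic_neq0 (monic_minPoly F t)) (root_minPoly F t).
  by rewrite Dr size_prod_XsubC size_map.
have trace0 : \sum_(rho <- r) rho t = 0.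
  pose ev (rho : gal_of {:L}) := rho t.
  apply/eqP; rewrite -oppr_eq0 -(big_map ev xpredT id).
  rewrite -coefPn_prod_XsubC ?size_map -?lt0n //.
  rewrite -[(size r).-1]/((size r).+1).-2 -(size_map ev).
  by rewrite -(size_prod_XsubC _ id) -Dr sub0.
pose c k := iota k * (iota k)^* / iota k ^+ m.+1.
have termE (sigma : gal_of {:L}) :
    iota (sigma ku) * (iota (sigma kv))^* = iota (sigma t) * c (sigma kv).
  have nz_skv : iota (sigma kv) ^+ m.+1 != 0.
    by rewrite expf_neq0 // !fmorph_eq0.
  rewrite /c rmorphM rmorphXn rmorphM rmorphXn /= -[RHS]mulrA.
  congr (_ * _); rewrite !mulrA -exprSr mulrAC divff //.
  by rewrite mul1r.
have cE (rho sigma : gal_of {:L}) : rho \in 'Gal({:L} / F)%g ->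
    c ((rho * sigma)%g kv) = c (sigma kv).
  (* [sigma kv] is determined by [sigma w] up to a root of unity. *)
  move=> Frho; have wE : (rho * sigma)%g kv ^+ m.+1 = sigma kv ^+ m.+1.
    rewrite galM ?memvf // -!rmorphXn /= (fixed_gal (subvf F) Frho) //.
    exact: memv_adjoin.
  have iwE : iota ((rho * sigma)%g kv) ^+ m.+1 = iota (sigma kv) ^+ m.+1.
    by rewrite -[LHS]rmorphXn wE rmorphXn.
  rewrite /c -!normCK iwE; congr (_ ^+ 2 / _).
  by apply: (@pexpIrn _ m.+1); rewrite ?nnegrE // -!normrX iwE.
have n0 : (size r)%:R != 0 :> algC by rewrite pnatr_eq0 -lt0n.
apply: (mulfI n0); rewrite mulr0 (eq_bigr _ (fun sigma _ => termE sigma)).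
transitivity (\sum_(rho <- r) \sum_(sigma in 'Gal({:L} / 1)%g)
    iota (sigma (rho t)) * c (sigma kv)).
  rewrite big_seq (eq_bigr (fun=> \sum_(sigma in 'Gal({:L} / 1)%g)
      iota (sigma t) * c (sigma kv))).
    by rewrite -big_seq big_const_seq count_predT iter_addr_0 mulr_natl.
  move=> rho /(fintype.subsetP rF) Frho.
  rewrite -[RHS](sum_gal_translate _ Frho).
  by apply: eq_bigr => sigma _; rewrite cE // galM ?memvf.
rewrite exchange_big big1 //= => sigma _.
by rewrite -mulr_suml -!rmorph_sum trace0 !rmorph0 mul0r.
Qed.

End Grading.
Hypothesis phi_int : forall x, phi x \in Aint.

(** If [x], homogeneous of degree [h], satisfies a monic equation of degree [n]
    over the integers, then some lower power [x ^+ i] must share the degree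
    [h *+ n] of the leading term. So [h *+ (n - i) = 0], and [n`!] kills [h]
    whatever the grading is. *)
Lemma degree_torsion (x : R) : x <> 0 -> exists2 m, (0 < m)%N &
  forall (H : zmodType) (S_ : H -> set R) h, is_grading S_ -> S_ h x ->
  h *+ m = 0.
Proof.
move=> x0; pose p := minCpoly (phi x); pose n := (size p).-1.
have sz_p : size p = n.+1.
  by rewrite /n prednK // (ltn_trans _ (size_minCpoly _)).
have /choice[a Da] i : exists a : int, p`_i = a%:~R.
  by apply/intrP; apply: (polyOverP (phi_int x)).
exists n`! => [|H S_ h gradS Sx]; first exact: fact_gt0.
have rel0 : \sum_(i < n.+1) x ^+ i *~ a i = 0.
  apply: phi_eq0; rewrite rmorph_sum /= -[RHS](eqP (root_minCpoly (phi x))).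
  rewrite horner_coef -/p sz_p; apply: eq_bigr => i _.
  by rewrite Da rmorphMz rmorphXn mulrzl.
have Sxa (i : 'I_n.+1) : S_ (h *+ i) (x ^+ i *~ a i).
  by apply: grading_intmul => //; apply: gradingX => //; apply: phi_dom.
have an1 : a n = 1.
  have := monicP (minCpoly_monic (phi x)).
  by rewrite lead_coefE -/p -/n Da => /(@intr_inj _ (a n) 1).
have := grading_component_eq0 gradS Sxa rel0 (h *+ n).
rewrite (bigD1 ord_max) ?eqxx //= an1 mulr1z.
have [i /andP[hi i_n] _|none] := pickP (fun i : 'I_n.+1 =>
    (h *+ i == h *+ n) && (i != ord_max)); last first.
  by rewrite big_pred0 // addr0 => xn0; case: (exp_neq0 phi_dom x0 xn0).
have lt_in : (i < n)%N.
  by rewrite ltn_neqAle -ltnS ltn_ord andbT; apply: i_n.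
have h_ni : h *+ (n - i) = 0.
  by rewrite mulrnBr ?(ltnW lt_in) // (eqP hi) subrr.
have /dvdnP[k ->] : (n - i %| n`!)%N.
  by apply: dvdn_fact; rewrite subn_gt0 lt_in leq_subr.
by rewrite mulnC mulrnA h_ni mul0rn.
Qed.

Lemma mean_sqnorm_ge1 (x : R) : x <> 0 -> 1 <= mean_sqnorm (phi x).
Proof.
move=> x0; have [L [iota iotaP]] := splitting_number_field [:: phi x].
have [k Dk] := iotaP _ (mem_head _ _).
have := @mean_sqnorm_ge1_gal L iota k; rewrite Dk; apply; first exact: phi_int.
by apply: contra_notN x0 => /eqP k0; apply: phi_eq0; rewrite -Dk k0 rmorph0.
Qed.

(** Pythagoras: in a Galois number field containing all the terms, the cross
    terms of the expanded squares sum to 0. *)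
Lemma mean_sqnorm_split (H : zmodType) (S_ : H -> set R) (s : seq H)
    (c : H -> R) h (y : R) :
    is_grading S_ -> (forall k, S_ k (c k)) -> S_ h y -> y <> 0 -> h \notin s ->
  mean_sqnorm (phi (y + \sum_(k <- s) c k)) =
    mean_sqnorm (phi y) + mean_sqnorm (phi (\sum_(k <- s) c k)).
Proof.
move=> gradS Sc Sy y0 hs.
have [m m0 ord_m] := degree_torsion y0; have hm := ord_m H S_ h gradS Sy.
have [L [iota iotaP]] :=
  splitting_number_field (phi y :: [seq phi (c k) | k <- s]).
have [ky Dy] := iotaP _ (mem_head _ _).
have /choice[kc Dc] k : exists l, k \in s -> iota l = phi (c k).
  have [ks|] := boolP (k \in s); last by exists 0.
  have [|l Dl] := iotaP (phi (c k)); last by exists l.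
  by rewrite in_cons (map_f (fun k => phi (c k)) ks) orbT.
pose kz := \sum_(k <- s) kc k; pose z := \sum_(k <- s) c k.
have Dz : iota kz = phi z.
  by rewrite !rmorph_sum big_seq [RHS]big_seq; apply: eq_bigr => k /Dc.
have orth : \sum_(sigma in 'Gal({:L} / 1)%g)
    iota (sigma kz) * (iota (sigma ky))^* = 0.
  rewrite (eq_bigr (fun sigma : gal_of {:L} =>
      \sum_(k <- s) iota (sigma (kc k)) * (iota (sigma ky))^*)); last first.
    by move=> sigma _; rewrite !rmorph_sum mulr_suml.
  rewrite exchange_big big_seq big1 //= => k ks.
  apply: (homogeneous_orthogonal gradS (Sc k) Sy _ m0 hm (Dc k ks) Dy).
  by apply: contraNneq hs => <-.
rewrite -/z rmorphD -Dy -Dz -rmorphD.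
have n0 : #|'Gal({:L} / 1)%g|%:R != 0 :> algC.
  by rewrite pnatr_eq0 -lt0n cardG_gt0.
apply: (mulfI n0); rewrite mulrDr -!sum_sqnorm_gal -big_split /=.
pose cross (sigma : gal_of {:L}) := iota (sigma kz) * (iota (sigma ky))^*.
transitivity (\sum_(sigma in 'Gal({:L} / 1)%g)
    (`|iota (sigma ky)| ^+ 2 + `|iota (sigma kz)| ^+ 2
      + (cross sigma + (cross sigma)^*))).
  apply: eq_bigr => sigma _; rewrite /cross [sigma _]rmorphD [iota _]rmorphD.
  move: (iota _) (iota _) => a b; rewrite !normCK rmorphD rmorphM /= conjCK.
  rewrite mulrDl !mulrDr [a^* * b]mulrC -!addrA; congr (_ + _).
  by rewrite addrC [a * b^* + a * a^*]addrC -addrA.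
rewrite big_split /= [X in _ + X]big_split /=.
by rewrite -rmorph_sum orth rmorph0 !addr0.
Qed.

(** As long as an element is not homogeneous in every grading, some grading
    splits it into two nonzero orthogonal pieces, each of which has a mean
    square norm smaller by at least 1. *)
Lemma sum_of_always_homogeneous (x : R) : exists2 s : seq R,
  (forall y, y \in s -> always_homogeneous y) & x = \sum_(y <- s) y.
Proof.
have [n] : exists n : nat, mean_sqnorm (phi x) < n%:R.
  by eexists; apply: archi_boundP; apply: mean_sqnorm_ge0.
elim: n x => [x|n IHn x lt_n]; first by rewrite le_gtF ?mean_sqnorm_ge0.
have [homx|] := pselect (always_homogeneous x).
  by exists [:: x]; [move=> y /[!inE] /eqP-> | rewrite big_seq1].
move=> /existsNP[H /existsNP[S_ /not_implyP[gradS nSx]]].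
have [s [c [us Sc x_sum]]] := grading_decomposition gradS x.
have [h [hs ch0]] : exists h, h \in s /\ c h <> 0.
  apply: contrapT => none; apply: nSx; exists 0; rewrite x_sum big_seq.
  rewrite big1 => [|h hs]; first exact: grading0.
  by apply: contrapT => ch0; apply: none; exists h.
pose s' := rem h s; pose z := \sum_(k <- s') c k.
have Dx : x = c h + z by rewrite x_sum (perm_big _ (perm_to_rem hs)) big_cons.
have z0 : z <> 0 by move=> z0; apply: nSx; exists h; rewrite Dx z0 addr0.
have hs' : h \notin s' by rewrite mem_rem_uniqF.
have Dmean := mean_sqnorm_split gradS Sc (Sc h) ch0 hs'.
rewrite Dx Dmean -/z in lt_n.
have [s1 hom1 D1] : exists2 s : seq R,
    (forall y, y \in s -> always_homogeneous y) & c h = \sum_(y <- s) y.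
  apply: IHn; rewrite -(ltrD2r 1) natr1.
  by apply: le_lt_trans lt_n; rewrite lerD2l mean_sqnorm_ge1.
have [s2 hom2 D2] : exists2 s : seq R,
    (forall y, y \in s -> always_homogeneous y) & z = \sum_(y <- s) y.
  apply: IHn; rewrite -(ltrD2l 1) nat1r.
  by apply: le_lt_trans lt_n; rewrite lerD2r mean_sqnorm_ge1.
exists (s1 ++ s2); last by rewrite big_cat -D1 -D2.
by move=> y; rewrite mem_cat => /orP[/hom1|/hom2].
Qed.

End IntegralSubring.

(* [R], via its injection [val] into [algC], is the subring with underlying
   set [S]; the hypothesis places it inside the ring of algebraic integers. *)
Theorem theorem1p7 (S : {pred algC}) (R : subComNzRingType S)
    (S_int : {subset S <= Aint}) :
  has_universal_grading R.
Proof.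
pose phi : {rmorphism R -> algC} := \val.
have phi_inj : injective phi by apply: val_inj.
have phi_int x : phi x \in Aint by apply/S_int/valP.
apply: universal_grading_exists.
- exact: phi_dom phi_inj.
- exact: degree_torsion phi_inj phi_int.
- exact: sum_of_always_homogeneous phi_inj phi_int.
Qed.
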